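(* Consider the differentially private distributed projected gradient descent algorithm described in the context, run on a database $D=\{\mathcal{C}_i\}_{i=1}^n$ with inputs $U$, $L$, $K$, $\{\alpha_k\}_{k=1}^K$, $\eta\ge 1$, $\Delta$ and $\epsilon$. Then the mechanism $M_p:=(\hat p^{(1)},\hat p^{(2)},\dots,\hat p^{(K)})$ that outputs all the noisy gradients preserves $\epsilon$-differential privacy under the adjacency relation $\mathrm{Adj}$ given in the context; that is, for all databases $D,D'$ with $\mathrm{Adj}(D,D')$ and all (measurable) $\mathcal{R}\subseteq\mathrm{range}(M_p)$, $$\mathbb{P}(M_p(D)\in\mathcal{R})\le e^{\epsilon}\,\mathbb{P}(M_p(D')\in\mathcal{R}).$$
   Context: $\|\cdot\|$ is the $\ell_2$-norm, $[n]=\{1,\dots,n\}$, and $\Pi_{\mathcal{C}}(x)$ is the $\ell_2$-projection of $x$ onto a nonempty convex set $\mathcal{C}$ (the unique minimizer of $\|\hat x-x\|^2$ over $\hat x\in\mathcal{C}$, assumed well defined). Problem: minimize $U(\sum_{i=1}^n r_i)$ over $r_1,\dots,r_n\in\mathbb{R}^T$ subject to $r_i\in\mathcal{C}_i$, $i\in[n]$. Here $U\colon\mathbb{R}^T\to\mathbb{R}$ is convex and differentiable with $\|\nabla U(x)-\nabla U(y)\|\le L\|x-y\|$ for all $x,y$ ($L>0$), and each $\mathcal{C}_i\subset\mathbb{R}^T$ is convex. Databases and adjacency: the sets belong to a parameterized family, $\mathcal{C}_i=\mathcal{C}(\beta_i)$ with $\beta_i\in\mathbb{R}^s$; given a metric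 $\rho$ on $\mathbb{R}^s$, set $\rho_{\mathcal{C}}(\mathcal{C}(\beta),\mathcal{C}(\beta')):=\rho(\beta,\beta')$. A database is $D=\{\mathcal{C}_i\}_{i=1}^n$. For a given constant $\delta\mathcal{C}\ge 0$, $\mathrm{Adj}(D,D')$ holds for $D=\{\mathcal{C}_i\}$, $D'=\{\mathcal{C}_i'\}$ if and only if there is $i\in[n]$ such that $\rho_{\mathcal{C}}(\mathcal{C}_i,\mathcal{C}_i')\le\delta\mathcal{C}$ and $\mathcal{C}_j=\mathcal{C}_j'$ for all $j\ne i$. Projection sensitivity: $$\Delta:=\max_{i\in[n]}\max\{\|\Pi_{\mathcal{C}_i}(r)-\Pi_{\mathcal{C}_i'}(r)\|\colon r\in\mathbb{R}^T,\ \mathcal{C}_i \text{ and } \mathcal{C}_i' \text{ satisfy } \rho_{\mathcal{C}}(\mathcal{C}_i,\mathcal{C}_i')\le\delta\mathcal{C}\},$$ with $0<\Delta<\infty$, and $\epsilon>0$, so that the noise densities below are defined. Algorithm: initialize $\{r_i^{(1)}\}_{i=1}^n$ arbitrarily (fixed independently of the database), let $\hat r_i^{(1)}=r_i^{(1)}$ and $\theta_k=(\eta+1)/(\eta+k)$. For $k=1,\dots,K$: (1) if $k=1$ set $w_1=0$; otherwise draw $w_k\in\mathbb{R}^T$ (independently of everything before) from the probability density proportional to $\exp\left(-\frac{2\epsilon\|w_k\|}{K(K-1)L\Delta}\right)$; (2) compute $\hat p^{(k)}:=\nabla U(\sum_{i=1}^n r_i^{(k)})+w_k$; (3) for $i\in[n]$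 compute $r_i^{(k+1)}:=\Pi_{\mathcal{C}_i}(r_i^{(k)}-\alpha_k\hat p^{(k)})$ and $\hat r_i^{(k+1)}:=(1-\theta_k)\hat r_i^{(k)}+\theta_k r_i^{(k+1)}$. The output is $\{\hat r_i^{(K+1)}\}_{i=1}^n$. *)

(* Defs.v *)
From HB Require Import structures.
From mathcomp Require Import all_boot all_order all_algebra.
From mathcomp Require Import finmap.
From mathcomp Require Import all_classical all_reals all_analysis.
Set Implicit Arguments.
Unset Strict Implicit.
Unset Printing Implicit Defensive.
Import Order.TTheory GRing.Theory Num.Theory.
Import numFieldNormedType.Exports.

Local Open Scope classical_set_scope.
Local Open Scope ring_scope.

Definition mx_display : measure_display. Proof. exact: default_measure_display. Qed.

(* Matrices carry the Borel sigma-algebra of their (product) topology. *)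
Section borel_mx.
Context {R : realType} (m n : nat).

Let borel0 : <<s @open 'M[R]_(m, n) >> set0.
Proof. exact: sigma_algebra0. Qed.

Let borelC (A : set 'M[R]_(m, n)) :
  <<s @open 'M[R]_(m, n) >> A -> <<s @open 'M[R]_(m, n) >> (~` A).
Proof. exact: sigma_algebraC. Qed.

Let borelU (F : (set 'M[R]_(m, n))^nat) :
  (forall i, <<s @open 'M[R]_(m, n) >> (F i)) ->
  <<s @open 'M[R]_(m, n) >> (\bigcup_i F i).
Proof. exact: sigma_algebra_bigcup. Qed.

HB.instance Definition _ := @isMeasurable.Build mx_display 'M[R]_(m, n)
  (<<s @open 'M[R]_(m, n) >>) borel0 borelC borelU.

End borel_mx.

(* Lebesgue measure on R^n, as the n-fold product of the one on R;
   R^0 is a single point of mass 1. *)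
Fixpoint lebesgue_rV (R : realType) (n : nat) : set 'rV[R]_n -> \bar R :=
  match n with
  | 0 => \d_(0 : 'rV[R]_0)
  | n'.+1 => pushforward (lebesgue_measure \x @lebesgue_rV R n')%E
      (fun p : measurableTypeR R * 'rV[R]_n' =>
         row_mx (const_mx p.1 : 'rV[R]_1) p.2 : 'rV[R]_n'.+1)
  end.

Section euclidean.
Context {R : realType} {T : nat}.
Implicit Types (x y : 'rV[R]_T) (C : set 'rV[R]_T) (U : 'rV[R]_T -> R).

(* The library norm of ['rV[R]_T] is the sup norm, hence this one. *)
Definition l2norm x : R := Num.sqrt (\sum_(j < T) x ord0 j ^+ 2).

Definition is_proj C x y : Prop :=
  C y /\ forall z, C z -> l2norm (y - x) ^+ 2 <= l2norm (z - x) ^+ 2.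

Definition proj_well_defined C : Prop := forall x, exists! y, is_proj C x y.

(* Meaningful when [proj_well_defined C]. *)
Definition proj C x : 'rV[R]_T := get (is_proj C x).

Definition grad U x : 'rV[R]_T := \row_(j < T) 'D_(delta_mx ord0 j) U x.

End euclidean.

Definition is_metric (R : realType) (X : Type) (rho : X -> X -> R) : Prop :=
  [/\ forall x y, 0 <= rho x y,
      forall x y, rho x y = 0 <-> x = y,
      forall x y, rho x y = rho y x &
      forall x y z, rho x z <= rho x y + rho y z].

Section databases.
Context {R : realType} {s T n : nat}.
Variables (C : 'rV[R]_s -> set 'rV[R]_T) (rho : 'rV[R]_s -> 'rV[R]_s -> R).
Variable dC : R.
Implicit Types (A : set 'rV[R]_T) (D : 'I_n -> set 'rV[R]_T).

Definition database D : Prop := forall i, exists b, D i = C b.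

(* rho_C(A, A') <= dC, the distance between two sets of the family being the
   distance between their parameters. *)
Definition rhoC_le A A' : Prop :=
  exists b b', [/\ A = C b, A' = C b' & rho b b' <= dC].

Definition Adj D D' : Prop :=
  exists i, rhoC_le (D i) (D' i) /\ forall j, j != i -> D j = D' j.

End databases.

Definition proj_sensitivity (R : realType) (s T n : nat)
    (C : 'rV[R]_s -> set 'rV[R]_T) (rho : 'rV[R]_s -> 'rV[R]_s -> R) (dC : R) :
    \bar R :=
  ereal_sup [set ereal_sup [set e | exists (r : 'rV[R]_T) A A',
      rhoC_le C rho dC A A' /\ e = (l2norm (proj A r - proj A' r))%:E]
    | _ in [set: 'I_n]].

Section algorithm.
Context {R : realType} {T n : nat}.
Variables (U : 'rV[R]_T -> R) (alpha : nat -> R) (eta : R).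
Variable r1 : 'I_n -> 'rV[R]_T.
Variable D : 'I_n -> set 'rV[R]_T.
(* A realization of the noise; only [w k] with [2 <= k] is used. *)
Variable w : nat -> 'rV[R]_T.

Definition theta (k : nat) : R := (eta + 1) / (eta + k%:R).

Definition noisy_grad (k : nat) (r : 'I_n -> 'rV[R]_T) : 'rV[R]_T :=
  grad U (\sum_(i < n) r i) + (if k == 1%N then 0 else w k).

(* [dpgd_iter k] is the pair (r^(k+1), rhat^(k+1)), i.e. the state after k
   iterations. *)
Fixpoint dpgd_iter (k : nat) : ('I_n -> 'rV[R]_T) * ('I_n -> 'rV[R]_T) :=
  match k with
  | 0 => (r1, r1)
  | k'.+1 =>
      let: (r, rhat) := dpgd_iter k' in
      let p := noisy_grad k r in
      let r' := fun i => proj (D i) (r i - alpha k *: p) in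
      (r', fun i => (1 - theta k) *: rhat i + theta k *: r' i)
  end.

(* phat^(k), for k >= 1 *)
Definition dpgd_phat (k : nat) : 'rV[R]_T := noisy_grad k (dpgd_iter k.-1).1.

Definition dpgd_output (K : nat) : 'I_n -> 'rV[R]_T := (dpgd_iter K).2.

(* (phat^(1), ..., phat^(K)) *)
Definition mech_p (K : nat) : K.-tuple 'rV[R]_T :=
  [tuple dpgd_phat k.+1 | k < K].

End algorithm.

Section probability.
Context {R : realType} {d : measure_display} {Omega : measurableType d}.
Variable P : probability Omega R.

Definition density_prop_to (T : nat) (X : {RV P >-> 'rV[R]_T})
    (g : 'rV[R]_T -> R) : Prop :=
  exists2 c : R, 0 < c & forall B : set 'rV[R]_T, measurable B ->
    distribution P X B = (\int[@lebesgue_rV R T]_(x in B) (c * g x)%:E)%E.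

Definition mutually_independent (d' : measure_display) (Y : measurableType d')
    (I : set nat) (X : nat -> {RV P >-> Y}) : Prop :=
  forall (J : {fset nat}) (B : nat -> set Y),
    [set` J] `<=` I -> (forall k, measurable (B k)) ->
    P (\bigcap_(k in [set` J]) X k @^-1` B k) =
    (\prod_(k <- J) P (X k @^-1` B k))%E.

Definition differentially_private (DB : Type) (d' : measure_display)
    (Y : measurableType d') (valid : set DB) (adj : DB -> DB -> Prop)
    (M : DB -> Omega -> Y) (eps : R) : Prop :=
  forall D D', valid D -> valid D' -> adj D D' ->
  forall S : set Y, measurable S ->
    (P (M D @^-1` S) <= (expR eps)%:E * P (M D' @^-1` S))%E.

End probability.

(* Main.v *)
Require Import Defs.
From HB Require Import structures.
From mathcomp Require Import all_boot all_order all_algebra.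
From mathcomp Require Import finmap.
From mathcomp Require Import all_classical all_reals all_analysis.
From mathcomp Require Import measurable_realfun ring lra.
Set Implicit Arguments.
Unset Strict Implicit.
Unset Printing Implicit Defensive.
Import Order.TTheory GRing.Theory Num.Theory.
Import numFieldNormedType.Exports.
Local Open Scope classical_set_scope.
Local Open Scope ring_scope.

(** Privacy of the noisy gradients is an adaptive composition of [K - 1]
    additive-noise mechanisms whose shifts grow linearly.

    Fix the gradients published so far.  Two runs on adjacent databases that have
    published the same gradients have equal iterates except at the one index
    where the databases differ; there, each step adds at most [Delta] to the gap,
    because a projection onto a convex set is nonexpansive and exchanging the set
    moves the projection by at most [Delta] ([iterates_gap]).  Hence after [m]
    steps the exact gradients differ by at most [L * m * Delta].

    The log-density of the noise is [gamma]-Lipschitz for the Euclidean norm, and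
    Lebesgue measure is translation invariant, so shifting the noise by [t]
    multiplies probabilities by at most [expR (gamma * l2norm t)]
    ([density_shift]).  Since the fresh noise is independent of the past
    ([past_independent]), the joint law of past and noise is a product, and these
    bounds multiply along the run ([adaptive_composition]).  The exponents
    [gamma * L * m * Delta] with [m < K] add up to
    [gamma * L * Delta * (K * (K - 1) / 2)], which is [eps] for
    [gamma = 2 * eps / (K * (K - 1) * L * Delta)].

    The measure-theoretic preparation consists of two facts about row vectors: a
    vector-valued function is Borel as soon as its coordinates are
    ([measurable_rVP]), and the iterated product [lebesgue_rV] is a sigma-finite
    translation-invariant measure ([lebesgue_rV_invariant_measure]). *)

(** * Euclidean geometry and projections *)

Section euclidean_geometry.
Context {R : realType} {T : nat}.
Implicit Types (x y z : 'rV[R]_T) (C : set 'rV[R]_T).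

Definition dot x y : R := \sum_(j < T) x ord0 j * y ord0 j.

Lemma dotC x y : dot x y = dot y x.
Proof. by apply: eq_bigr => j _; rewrite mulrC. Qed.

Lemma dotDl x y z : dot (x + y) z = dot x z + dot y z.
Proof. by rewrite -big_split/=; apply: eq_bigr => j _; rewrite mxE mulrDl. Qed.

Lemma dotZl a x y : dot (a *: x) y = a * dot x y.
Proof. by rewrite mulr_sumr; apply: eq_bigr => j _; rewrite mxE mulrA. Qed.

Lemma dotNl x y : dot (- x) y = - dot x y.
Proof. by rewrite -scaleN1r dotZl mulN1r. Qed.

Lemma dotDr x y z : dot z (x + y) = dot z x + dot z y.
Proof. by rewrite dotC dotDl !(dotC z). Qed.

Lemma dotZr a x y : dot x (a *: y) = a * dot x y.
Proof. by rewrite dotC dotZl dotC. Qed.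

Lemma dotNr x y : dot x (- y) = - dot x y.
Proof. by rewrite dotC dotNl dotC. Qed.

Definition dotE := (dotDl, dotDr, dotNl, dotNr, dotZl, dotZr).

Lemma dot_ge0 x : 0 <= dot x x.
Proof. by apply: sumr_ge0 => j _; rewrite -expr2 sqr_ge0. Qed.

Lemma l2norm_ge0 x : 0 <= l2norm x.
Proof. exact: sqrtr_ge0. Qed.

Lemma sqr_l2norm x : l2norm x ^+ 2 = dot x x.
Proof.
rewrite sqr_sqrtr; last by apply: sumr_ge0 => j _; exact: sqr_ge0.
by apply: eq_bigr => j _; rewrite expr2.
Qed.

Lemma l2norm0 : l2norm (0 : 'rV[R]_T) = 0.
Proof. by rewrite /l2norm big1 ?sqrtr0// => j _; rewrite mxE expr0n. Qed.

(** The squared norm of [dot y y *: x - dot x y *: y] is nonnegative. *)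
Lemma CauchySchwarz_dot x y : dot x y <= l2norm x * l2norm y.
Proof.
suff : dot x y ^+ 2 <= dot x x * dot y y.
  rewrite -!sqr_l2norm -exprMn => /(ler_wsqrtr); rewrite !sqrtr_sqr.
  rewrite [X in _ <= X -> _]ger0_norm; last by rewrite mulr_ge0 ?l2norm_ge0.
  exact/le_trans/ler_norm.
have [y0|] := eqVneq (dot y y) 0.
  suff -> : y = 0 by rewrite -(scale0r 0) !dotE !mul0r mulr0 expr0n.
  apply/rowP => j; rewrite mxE; apply/eqP; rewrite -sqrf_eq0 expr2; apply/eqP.
  by move: y0 => /psumr_eq0P-> // i _; rewrite -expr2 sqr_ge0.
rewrite neq_lt ltNge dot_ge0/= => y0.
have := dot_ge0 (dot y y *: x - dot x y *: y).
rewrite !dotE (dotC y x) (_ : _ + _ = dot y y * (dot x x * dot y y - dot x y ^+ 2)).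
  by rewrite pmulr_rge0// subr_ge0.
by ring.
Qed.

Lemma ler_l2normD x y : l2norm (x + y) <= l2norm x + l2norm y.
Proof.
rewrite -(@ler_pXn2r _ 2)// ?nnegrE ?addr_ge0 ?l2norm_ge0//.
have := CauchySchwarz_dot x y.
rewrite sqrrD !sqr_l2norm !dotE (dotC y x).
lra.
Qed.

Lemma ler_abs_l2norm x j : `|x ord0 j| <= l2norm x.
Proof.
rewrite -sqrtr_sqr ler_wsqrtr// (bigD1 j)//= lerDl.
by apply: sumr_ge0 => i _; exact: sqr_ge0.
Qed.

Lemma l2norm_ler_sup x e : (forall j, `|x ord0 j| <= e) ->
  l2norm x <= Num.sqrt T%:R * `|e|.
Proof.
move=> xe; rewrite -sqrtr_sqr -sqrtrM// ler_wsqrtr//.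
rewrite -[T in T%:R]card_ord -sum1_card natr_sum mulr_suml.
apply: ler_sum => j _; rewrite mul1r -real_normK ?num_real//.
rewrite -(real_normK (num_real e)) ler_pXn2r ?nnegrE//.
exact: le_trans (xe j) (ler_norm _).
Qed.

(** First-order optimality: the segment from the projection [y] to a point [z]
    of the convex set stays in the set, so the squared distance to [x] cannot
    decrease at [y] along it. *)
Lemma proj_variational C x y z : @convex_set R 'rV[R]_T C ->
  is_proj C x y -> C z -> dot (x - y) (z - y) <= 0.
Proof.
move=> Cconv [Cy ymin] Cz; rewrite -oppr_ge0 -dotNl opprB.
set a := dot _ _; rewrite leNgt; apply/negP => a0.
set b := dot (z - y) (z - y).
have b0 : 0 <= b by exact: dot_ge0.
(* The minimizer -a/b of 2ta + t^2 b, with b enlarged to b - a so that it lies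
   in ]0, 1]. *)
have t01 : 0 <= - a / (b - a) <= 1.
  by rewrite divr_ge0 ?ler_pdivrMr ?mul1r//; lra.
pose t : {i01 R} := Itv01 (andP t01).1 (andP t01).2.
have := Cconv z y t (mem_set Cz) (mem_set Cy).
rewrite inE /conv/= => /ymin; rewrite !sqr_l2norm.
have -> : - a / (b - a) *: z + (1 - - a / (b - a)) *: y - x
        = (y - x) + (- a / (b - a)) *: (z - y).
  by rewrite scalerBr scalerBl scale1r; apply/rowP => j; rewrite !mxE; ring.
set s := - a / (b - a).
have s0 : 0 < s by rewrite divr_gt0; lra.
have sE : s * (b - a) = - a by rewrite /s divfK//; lra.
have -> : dot (y - x + s *: (z - y)) (y - x + s *: (z - y)) =
          dot (y - x) (y - x) + s * (2 * a + s * b).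
  rewrite /a /b; move: (y - x) (z - y) => u v.
  by rewrite !dotE (dotC v u); ring.
rewrite lerDl pmulr_rge0//; nra.
Qed.

(** Add the variational inequalities of the two projections, each tested at the
    other one, and conclude by Cauchy-Schwarz. *)
Lemma proj_nonexpansive C x y : @convex_set R 'rV[R]_T C ->
  proj_well_defined C -> l2norm (Defs.proj C x - Defs.proj C y) <= l2norm (x - y).
Proof.
move=> Cconv Cproj.
have isP u : is_proj C u (Defs.proj C u).
  by have [v [Cv _]] := Cproj u; apply: (@getPex _ (is_proj C u)); exists v.
move: (Defs.proj C x) (Defs.proj C y) (isP x) (isP y) => p q px qy.
have := proj_variational Cconv px qy.1.
have := proj_variational Cconv qy px.1 => yq xp.
have : dot (p - q) (p - q) <= dot (x - y) (p - q).
  move: yq xp; rewrite -(opprB p q) dotNr.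
  rewrite !(dotDl _ _ (p - q)) !dotNl.
  by move: (dot x _) (dot y _) (dot p _) (dot q _) => a b c d; lra.
have := CauchySchwarz_dot (x - y) (p - q).
rewrite -sqr_l2norm; set m := l2norm _; set k := l2norm (p - q) => xy kk.
have k0 : 0 <= k by exact: l2norm_ge0.
have [->|k1] := eqVneq k 0; first exact: l2norm_ge0.
by rewrite -(@ler_pM2r _ k) ?lt_def ?k1// -expr2; exact: le_trans kk xy.
Qed.

End euclidean_geometry.

(** The topology of row vectors is that of the sup norm, so this rests on the
    equivalence of the two norms. *)
Lemma l2norm_lipschitz_continuous (R : realType) (m n : nat)
    (f : 'rV[R]_m -> 'rV[R]_n) (M : R) : 0 <= M ->
  (forall x y, l2norm (f x - f y) <= M * l2norm (x - y)) -> continuous f.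
Proof.
move=> M0 fM x A /nbhs_ballP[e /= e0 eA].
pose d := e / (M * Num.sqrt m%:R + 1).
have D0 : 0 < M * Num.sqrt m%:R + 1 by rewrite ltr_pwDr// mulr_ge0// sqrtr_ge0.
have d0 : 0 < d by rewrite divr_gt0.
apply/nbhs_ballP; exists d => //= y [_ xy].
apply: eA; split=> // i j; rewrite ord1 /ball/=.
have -> : f x ord0 j - f y ord0 j = (f x - f y) ord0 j by rewrite !mxE.
apply: le_lt_trans (ler_abs_l2norm _ _) _; apply: le_lt_trans (fM _ _) _.
have /l2norm_ler_sup xyd : forall k, `|(x - y) ord0 k| <= d.
  by move=> k; rewrite !mxE; exact/ltW/xy.
apply: le_lt_trans (ler_wpM2l M0 xyd) _.
rewrite (gtr0_norm d0) mulrA /d mulrCA gtr_pMr// ltr_pdivrMr// mul1r.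
by rewrite ltrDl.
Qed.

(** * Borel functions with values in row vectors *)

Section borel_rV.
Context {R : realType}.

Lemma continuous_measurable_mx (m n p q : nat) (f : 'M[R]_(m, n) -> 'M[R]_(p, q)) :
  continuous f -> measurable_fun setT f.
Proof.
move=> /continuousP fo; apply: (measurability (@open 'M[R]_(p, q))) => //.
by move=> _ [A oA <-]; rewrite setTI; apply: sub_sigma_algebra; exact: fo.
Qed.

Lemma measurable_coord (T : nat) j :
  measurable_fun setT (fun x : 'rV[R]_T => x ord0 j).
Proof.
apply: (measurability _ (RGenOpens.measurableE R)) => //.
move=> _ [_ [a [b ->]] <-]; rewrite setTI; apply: sub_sigma_algebra => /=.
by have /continuousP := @coord_continuous R 1 T ord0 j; apply; exact: interval_open.
Qed.

(** Balls with rational centre and radius form a countable base of the topology,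
    and membership in such a ball is a finite conjunction of conditions on the
    coordinates. *)
Lemma measurable_rVP d (Y : measurableType d) (T : nat) (f : Y -> 'rV[R]_T) :
  (forall j, measurable_fun setT (fun y => f y ord0 j)) -> measurable_fun setT f.
Proof.
move=> mf; apply: (measurability (@open 'rV[R]_T)) => //.
move=> _ [A oA <-]; rewrite setTI.
pose c (qe : 'rV[rat]_T * rat) : 'rV[R]_T := map_mx ratr qe.1.
pose F (qe : 'rV[rat]_T * rat) : set Y :=
  if `[< ball (c qe) (ratr qe.2) `<=` A >] then f @^-1` ball (c qe) (ratr qe.2)
  else set0.
have -> : f @^-1` A = \bigcup_qe F qe.
  apply/seteqP; split=> [y Afy|y [qe _]]; rewrite /F; last first.
    by case: ifPn => [/asboolP sub fy|//]; exact: sub.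
  have /nbhs_ballP[e/= e0 eA] : nbhs (f y) A by exact: open_nbhs_nbhs.
  have /rat_in_itvoo[r] : 0 < e / 2 by rewrite divr_gt0.
  rewrite in_itv/= => /andP[r0 re].
  have /choice[q fq] j : exists q : rat, `|ratr q - f y ord0 j| < ratr r.
    have /rat_in_itvoo[q] : f y ord0 j - ratr r < f y ord0 j + ratr r by lra.
    by rewrite in_itv/= => qr; exists q; rewrite ltr_distl.
  have ycr : ball (c (\row_j q j, r)) (ratr r) (f y).
    by split=> // i j; rewrite ord1 /ball/= !mxE.
  exists (\row_j q j, r) => //; rewrite asboolT// => z cz; apply: eA.
  apply: (@le_ball _ _ _ (ratr r + ratr r)); first by lra.
  exact: ball_triangle (ball_sym ycr) cz.
apply: countable_bigcupT_measurable => // qe; rewrite /F; case: ifPn => // _.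
case: (ltP 0 (ratr qe.2 : R)) => [q0|q0]; last first.
  rewrite (_ : _ @^-1` _ = set0)//; apply/seteqP; split=> // y [].
  by rewrite ltNge q0.
rewrite (_ : _ @^-1` _ =
  \big[setI/setT]_(j < T) ((fun y => f y ord0 j) @^-1` ball (c qe ord0 j) (ratr qe.2))).
  apply: bigsetI_measurable => j _; rewrite -[X in measurable X]setTI.
  by apply: mf => //; exact: measurable_ball.
rewrite -bigcap_seq; apply/seteqP; split=> y /=.
  by move=> [_ h] j _; exact: h.
by move=> h; split=> // i j; rewrite ord1; apply: h; rewrite /= mem_index_enum.
Qed.

Lemma measurable_rV_add d (Y : measurableType d) (T : nat) (f g : Y -> 'rV[R]_T) :
  measurable_fun setT f -> measurable_fun setT g ->
  measurable_fun setT (fun y => f y + g y).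
Proof.
move=> mf mg; apply: measurable_rVP => j; under eq_fun do rewrite mxE.
by apply: measurable_funD; apply: (measurableT_comp (measurable_coord j)).
Qed.

Lemma measurable_l2norm (T : nat) : measurable_fun setT (@l2norm R T).
Proof.
apply: (measurableT_comp (continuous_measurable_fun (@sqrt_continuous R))).
apply: measurable_sum => j; apply: measurable_funX; exact: measurable_coord.
Qed.

End borel_rV.

(** * Lebesgue measure on row vectors *)

Section lebesgue_rV.
Context {R : realType}.

Lemma product_sigma_finite d1 d2 (X : measurableType d1) (Y : measurableType d2)
    (mu : {sigma_finite_measure set X -> \bar R})
    (nu : {sigma_finite_measure set Y -> \bar R}) :
  sigma_finite setT (mu \x nu)%E.
Proof.
have /sigma_finiteP[F [FT Fmono Foo]] := sigma_finiteT mu.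
have /sigma_finiteP[G [GT Gmono Goo]] := sigma_finiteT nu.
exists (fun k => F k `*` G k).
  apply/seteqP; split=> // -[x y] _.
  have [i _ Fx] : (\bigcup_i F i) x by rewrite -FT.
  have [j _ Gy] : (\bigcup_j G j) y by rewrite -GT.
  exists (maxn i j) => //; split.
    by move: Fx; apply/subsetPset/Fmono/leq_maxl.
  by move: Gy; apply/subsetPset/Gmono/leq_maxr.
move=> k; have [mF Fk] := Foo k; have [mG Gk] := Goo k.
split; first exact: measurableX.
by rewrite product_measure1E// lte_mul_pinfty// ge0_fin_numE.
Qed.

(** The left inverse transports an exhausting sequence of sets of finite measure.
    The result is packaged as a structure because the product with a further
    factor requires one. *)
Lemma pushforward_sigma_finite d1 d2 (X : measurableType d1)
    (Y : measurableType d2) (mu : {measure set X -> \bar R})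
    (f : X -> Y) (g : Y -> X) :
  sigma_finite setT mu ->
  measurable_fun setT f -> measurable_fun setT g -> cancel f g ->
  exists nu : {sigma_finite_measure set Y -> \bar R},
    nu = pushforward mu f :> (set Y -> \bar R).
Proof.
move=> [F FT Foo] mf mg fK.
have sf : sigma_finite setT (pushforward mu f).
  exists (fun k => g @^-1` F k); first by rewrite -preimage_bigcup -FT.
  move=> k; have [mF Fk] := Foo k; split.
    by rewrite -[X in measurable X]setTI; exact: mg.
  by rewrite /pushforward -comp_preimage (_ : g \o f = id)//; apply/funext.
pose M := HB.pack_for {measure set Y -> \bar R} (pushforward mu f).
pose sfM := Measure_isSigmaFinite.Build _ _ _ (M mf) sf.
pose N := HB.pack_for {sigma_finite_measure set Y -> \bar R}
  (pushforward mu f) (Measure.class (M mf)) sfM.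
by exists (N mf).
Qed.

Lemma lebesgue_measure_shift (a : R) (A : set R) : measurable A ->
  pushforward lebesgue_measure (fun x : measurableTypeR R => x + a : measurableTypeR R) A
  = lebesgue_measure A.
Proof.
move=> mA; apply/esym/lebesgue_measure_unique => //=.
  by apply: measurable_funD => //; exact: measurable_cst.
move=> _ _ [[b c]] _ <-; rewrite /pushforward.
rewrite (_ : _ @^-1` _ = `]b - a, c - a]%classic); last first.
  by apply/seteqP; split=> x; rewrite /= !in_itv/= ltrBlDr lerBrDr.
rewrite !lebesgue_measure_itv/= !lte_fin ltrD2r -!EFinB.
by rewrite opprB addrA subrK.
Qed.

(** Induction on the dimension: splitting off the first coordinate conjugates a
    translation to a product of translations, and a product measure is determined
    by its values on rectangles, where the invariance of both factors applies. *)
Lemma lebesgue_rV_invariant_measure (n : nat) :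
  exists2 nu : {sigma_finite_measure set 'rV[R]_n -> \bar R},
    @lebesgue_rV R n = nu &
    forall (a : 'rV[R]_n) (B : set 'rV[R]_n), measurable B ->
      nu ((fun x => x + a) @^-1` B) = nu B.
Proof.
elim: n => [|n [nu nuE nuT]].
  exists \d_(0 : 'rV[R]_0) => // a B _; congr (\d_ _ _).
  by apply/seteqP; split=> x/=; rewrite [_ + a]thinmx0 [x]thinmx0.
pose glue (p : measurableTypeR R * 'rV[R]_n) : 'rV[R]_n.+1 :=
  row_mx (const_mx p.1 : 'rV[R]_1) p.2.
pose split (x : 'rV[R]_n.+1) : measurableTypeR R * 'rV[R]_n :=
  (x ord0 ord0, \row_j x ord0 (lift ord0 j)).
have glueL p : glue p ord0 ord0 = p.1.
  by rewrite mxE; case: splitP => // k _; rewrite mxE.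
have glueR p j : glue p ord0 (lift ord0 j) = p.2 ord0 j.
  rewrite mxE; case: splitP => [k|k [jk]]; first by rewrite ord1.
  by congr (p.2 _ _); exact/val_inj/esym.
have mglue : measurable_fun setT glue.
  apply: measurable_rVP => j; case: (unliftP ord0 j) => [k ->|->].
    under eq_fun do rewrite glueR.
    exact: (measurableT_comp (measurable_coord k)).
  by under eq_fun do rewrite glueL; exact: measurable_fst.
have msplit : measurable_fun setT split.
  apply/measurable_fun_pairP; split; first exact: measurable_coord.
  apply: measurable_rVP => j; rewrite /split/=; under eq_fun do rewrite mxE.
  exact: measurable_coord.
have glueK : cancel glue split.
  move=> [x y]; rewrite /split glueL; congr pair.
  by apply/rowP => j; rewrite mxE glueR.
pose leb : {sigma_finite_measure set (measurableTypeR R) -> \bar R} :=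
  lebesgue_measure.
have [mu muE] :=
  pushforward_sigma_finite (product_sigma_finite leb nu) mglue msplit glueK.
exists mu; first by rewrite /= nuE muE.
move=> a B mB; rewrite muE /pushforward.
pose shift (p : measurableTypeR R * 'rV[R]_n) : measurableTypeR R * 'rV[R]_n :=
  (p.1 + (split a).1, p.2 + (split a).2).
have mshift : measurable_fun setT shift.
  apply/measurable_fun_pairP; split.
    by apply: measurable_funD => //; exact: measurable_cst.
  by apply: measurable_rV_add => //; exact: measurable_cst.
pose mu' := HB.pack_for {measure set (measurableTypeR R * 'rV[R]_n)%type -> \bar R}
  (pushforward (leb \x nu)%E shift).
have -> : glue @^-1` ((fun x => x + a) @^-1` B) = shift @^-1` (glue @^-1` B).
  apply/seteqP; suff gs p : glue (shift p) = glue p + a by split=> p /=; rewrite gs.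
  apply/rowP => j; rewrite [RHS]mxE; case: (unliftP ord0 j) => [k ->|->].
    by rewrite !glueR !mxE.
  by rewrite !glueL.
have mgB : measurable (glue @^-1` B) by rewrite -[X in measurable X]setTI; exact: mglue.
apply/esym/(@product_measure_unique _ _ _ _ _ _ _ (mu' mshift)) => // A C mA mC.
rewrite /= /pushforward.
have -> : shift @^-1` (A `*` C) =
  ((fun x : measurableTypeR R => x + (split a).1) @^-1` A) `*`
  ((fun x => x + (split a).2) @^-1` C) by [].
rewrite product_measure1E//=.
- by rewrite nuT//; congr (_ * _)%E; exact: lebesgue_measure_shift.
- rewrite -[X in measurable X]setTI; apply: (_ : measurable_fun _ _) => //.
  by apply: measurable_funD => //; exact: measurable_cst.
- rewrite -[X in measurable X]setTI; apply: (_ : measurable_fun _ _) => //.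
  by apply: measurable_rV_add => //; exact: measurable_cst.
Qed.

End lebesgue_rV.

Section translation.
Context {R : realType} {T : nat}.
Implicit Types (a b t : 'rV[R]_T) (B : set 'rV[R]_T).

Lemma measurable_translate t : measurable_fun setT (fun x : 'rV[R]_T => t + x).
Proof. by apply: measurable_rV_add => //; exact: measurable_cst. Qed.

Lemma measurable_preimage_translate t B : measurable B ->
  measurable ((fun x => t + x) @^-1` B).
Proof.
by move=> mB; rewrite -[X in measurable X]setTI; exact: measurable_translate.
Qed.

(** The change of variables [y = t + x] turns the right-hand side into the
    integral of [f (t + x)] over the translated set. *)
Lemma integral_translate_le (f : 'rV[R]_T -> R) (k : R) t B :
  measurable_fun setT f -> (forall x, 0 <= f x) -> 0 <= k ->
  (forall x, f x <= k * f (t + x)) -> measurable B ->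
  (\int[@lebesgue_rV R T]_(x in (fun x => (t + x)%R) @^-1` B) (f x)%:E <=
   k%:E * \int[@lebesgue_rV R T]_(x in B) (f x)%:E)%E.
Proof.
move=> mf f0 k0 fk mB.
have [nu -> nuT] := @lebesgue_rV_invariant_measure R T.
have mfE : measurable_fun setT (fun x => (f x)%:E) by exact/measurable_EFinP.
have mfB : measurable_fun B (fun x => (f x)%:E) by exact: measurable_funS mfE.
have -> : (\int[nu]_(x in B) (f x)%:E =
    \int[nu]_(x in (fun x => (t + x)%R) @^-1` B) (f (t + x)%R)%:E)%E.
  rewrite -(ge0_integral_pushforward (measurable_translate t) _ mB mfB); last first.
    by move=> x _; rewrite lee_fin.
  have nutE (A : set 'rV[R]_T) : measurable A -> A `<=` B ->
      nu A = pushforward nu (fun x => t + x) A.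
    move=> mA _; rewrite -[LHS](nuT t)// /pushforward; congr (nu _).
    by apply/seteqP; split=> x /=; rewrite addrC.
  pose tnu := HB.pack_for {measure set 'rV[R]_T -> \bar R}
    (pushforward nu (fun x => t + x)).
  exact: (@eq_measure_integral _ _ _ _ (tnu (measurable_translate t)) nu _ nutE).
have mtB := measurable_preimage_translate t mB.
have mftE : measurable_fun setT (fun x => (f (t + x))%:E).
  exact: (measurableT_comp mfE (measurable_translate t)).
rewrite -ge0_integralZl_EFin//; last 2 first.
- by move=> x _; rewrite lee_fin.
- exact: measurable_funS mftE.
apply: ge0_le_integral => //.
- by move=> x _; rewrite lee_fin f0.
- exact: measurable_funS mfE.
- by apply: measurable_funeM; exact: measurable_funS mftE.
- by move=> x _; rewrite -EFinM lee_fin fk.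
Qed.

(** The triangle inequality makes the log-density [gamma]-Lipschitz. *)
Lemma density_shift d (Omega : measurableType d) (P : probability Omega R)
    (X : {RV P >-> 'rV[R]_T}) (gamma : R) :
  0 <= gamma -> density_prop_to X (fun x => expR (- (gamma * l2norm x))) ->
  forall a b B, measurable B ->
    (distribution P X ((fun x => (a + x)%R) @^-1` B) <=
     (expR (gamma * l2norm (a - b)))%:E *
     distribution P X ((fun x => (b + x)%R) @^-1` B))%E.
Proof.
move=> gamma0 [c c0 Xc] a b B mB.
have mbB := measurable_preimage_translate b mB.
rewrite (_ : (fun x => a + x) @^-1` B =
    (fun x => (a - b) + x) @^-1` ((fun x => b + x) @^-1` B)); last first.
  by apply/seteqP; split=> x; rewrite /= addrA subrKC.
rewrite !Xc//; last exact: measurable_preimage_translate.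
apply: integral_translate_le => //.
- apply: measurable_funM; first exact: measurable_cst.
  apply: measurableT_comp => //; apply: measurable_funN.
  apply: measurable_funM; [exact: measurable_cst|exact: measurable_l2norm].
- by move=> x; rewrite mulr_ge0 ?expR_ge0// ltW.
move=> x; move: (a - b) => t; rewrite mulrCA ler_pM2l// -expRD ler_expR.
rewrite -mulrBr -mulrN ler_wpM2l//.
by have := ler_l2normD t x; lra.
Qed.

End translation.

(** * Adaptive composition *)

Section adaptive_composition.
Context {R : realType} {d dY dZ dV : measure_display} {Omega : measurableType d}
  {Y : measurableType dY} {Z : measurableType dZ} {V : measurableType dV}
  (P : probability Omega R).
Local Open Scope ereal_scope.

Definition independent_pair (X : Omega -> Y) (W : Omega -> Z) : Prop :=
  forall A B, measurable A -> measurable B ->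
    P (X @^-1` A `&` W @^-1` B) = P (X @^-1` A) * P (W @^-1` B).

(** The joint law agrees with the product of the marginals on rectangles, hence
    everywhere; the right-hand side is that product measure of [S]. *)
Lemma independent_pair_law (X : {RV P >-> Y}) (W : {RV P >-> Z}) S :
  independent_pair X W -> measurable S ->
  P ((fun o => (X o, W o)) @^-1` S) =
  \int[distribution P X]_y distribution P W (xsection S y).
Proof.
move=> XW mS.
have mXW : measurable_fun setT (fun o => (X o, W o)).
  by apply: measurable_fun_pair; exact: measurable_funPT.
pose m := HB.pack_for {measure set (Y * Z)%type -> \bar R}
  (pushforward P (fun o => (X o, W o))).
exact/esym/(@product_measure_unique _ _ _ _ _ _ _ (m mXW)).
Qed.

(** Conditioning on the common past [y], the two mechanisms differ only in the
    kernels [f y] and [f' y] applied to the same fresh noise; the two factors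
    come from comparing the kernels fibrewise and then the laws of the past. *)
Lemma adaptive_composition (X X' : {RV P >-> Y}) (W : {RV P >-> Z})
    (f f' : Y * Z -> V) (a b : R) :
  independent_pair X W -> independent_pair X' W ->
  measurable_fun setT f -> measurable_fun setT f' -> (0 <= a)%R -> (0 <= b)%R ->
  (forall A, measurable A -> P (X @^-1` A) <= a%:E * P (X' @^-1` A)) ->
  (forall y B, measurable B -> P (W @^-1` [set z | B (f (y, z))]) <=
     b%:E * P (W @^-1` [set z | B (f' (y, z))])) ->
  forall S, measurable S ->
    P [set o | S (X o, f (X o, W o))] <=
    (a * b)%:E * P [set o | S (X' o, f' (X' o, W o))].
Proof.
move=> XW X'W mf mf' a0 b0 aXX' bff' S mS.
pose G (h : Y * Z -> V) := [set p : Y * Z | S (p.1, h p)].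
have mG h : measurable_fun setT h -> measurable (G h).
  move=> mh; rewrite -[X in measurable X]setTI.
  by apply: (measurable_fun_pair measurable_fst mh).
have sG h y : xsection (G h) y = [set z | xsection S y (h (y, z))].
  by apply/seteqP; split=> z; rewrite /xsection/= !inE.
rewrite [X in P X <= _](_ : _ = (fun o => (X o, W o)) @^-1` G f)//.
rewrite [X in _ * P X](_ : _ = (fun o => (X' o, W o)) @^-1` G f')//.
rewrite !independent_pair_law//; [|exact: mG|exact: mG].
set h := fun y => distribution P W (xsection (G f) y).
set h' := fun y => distribution P W (xsection (G f') y).
have mh : measurable_fun setT h by apply: measurable_fun_xsection; exact: mG.
have mh' : measurable_fun setT h' by apply: measurable_fun_xsection; exact: mG.
apply: (@le_trans _ _ (\int[distribution P X]_y (b%:E * h' y))).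
  apply: ge0_le_integral => //.
  - exact: measurable_funeM.
  - move=> y _; rewrite /h /h' !sG; apply: bff'; exact: measurable_xsection.
rewrite ge0_integralZl_EFin// mulrC EFinM -muleA lee_wpmul2l ?lee_fin//.
have -> : a%:E = (NngNum a0)%:num%:E by [].
rewrite -ge0_integral_mscale//; apply: ge0_le_measure_integral => //.
Qed.

End adaptive_composition.

(** * Independence of the fresh noise from the past *)

Section past_independence.
Context {R : realType} {d dZ : measure_display} {Omega : measurableType d}
  {Z : measurableType dZ} (P : probability Omega R).
Variable w : nat -> {RV P >-> Z}.

(** The cylinders of the variables indexed by [J]: a pi-system generating the
    sigma-algebra of the events known once these variables are observed. *)
Definition cylinders (J : {fset nat}) : set (set Omega) :=
  [set A | exists B : nat -> set Z, (forall k, measurable (B k)) /\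
    A = \bigcap_(k in [set` J]) w k @^-1` B k].

Lemma cylinders_measurable J : cylinders J `<=` measurable.
Proof.
move=> _ [B [mB ->]]; apply: bigcap_measurableType => k _.
by rewrite -[X in measurable X]setTI; exact: measurable_funPT.
Qed.

Lemma cylinders_setI_closed J : setI_closed (cylinders J).
Proof.
move=> _ _ [B [mB ->]] [C [mC ->]]; exists (fun k => B k `&` C k); split.
  by move=> k; exact: measurableI.
by rewrite -bigcapI.
Qed.

(** The sigma-algebra generated by the observed variables is put on [Omega]
    itself, so that being a function of them is plain measurability. *)
Lemma measurable_observed (J : {fset nat}) k : k \in J ->
  measurable_fun setT (w k : g_sigma_algebraType (cylinders J) -> Z).
Proof.
move=> kJ _ B mB; rewrite setTI; apply: sub_sigma_algebra.
exists (fun j => if j == k then B else setT); split.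
  by move=> j; case: ifP.
apply/seteqP; split=> [x wB j _ /=|x]; first by case: eqP => [->|].
by move=> /(_ k kJ) /=; rewrite eqxx.
Qed.

Lemma observed_measurable dY (Y : measurableType dY) J (X : Omega -> Y) :
  measurable_fun setT (X : g_sigma_algebraType (cylinders J) -> Y) ->
  measurable_fun setT X.
Proof.
move=> mX _ B mB; have := mX measurableT B mB.
apply: smallest_sub; first exact: sigma_algebra_measurable.
exact: cylinders_measurable.
Qed.

(** For [E] an event about [w k], the finite measures sending [A] to
    [P (A `&` E)] and to [P E * P A] agree on the cylinders, by the product rule
    for the family [k |` J]; so they agree on the generated sigma-algebra. *)
Lemma past_independent (I : set nat) (J : {fset nat}) k
    dY (Y : measurableType dY) (X : Omega -> Y) :
  mutually_independent I w -> [set` J] `<=` I -> I k -> k \notin J ->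
  measurable_fun setT (X : g_sigma_algebraType (cylinders J) -> Y) ->
  independent_pair P X (w k).
Proof.
move=> wI JI Ik kJ mX A B mA mB.
have mwB : measurable (w k @^-1` B).
  by rewrite -[X in measurable X]setTI; exact: measurable_funPT.
pose q := NngNum (fine_ge0 (measure_ge0 P (w k @^-1` B))).
pose m1 : {measure set Omega -> \bar R} := mrestr P mwB.
pose m2 : {measure set Omega -> \bar R} := mscale q P.
have qE : q%:num%:E = P (w k @^-1` B) by rewrite /= fineK// fin_num_measure.
have m1E C : m1 C = P (C `&` w k @^-1` B) by [].
have m2E C : m2 C = (P (w k @^-1` B) * P C)%E by rewrite -qE.
suff : m1 (X @^-1` A) = m2 (X @^-1` A) by rewrite m1E m2E muleC.
have HE : [set E | cylinders J E /\ E `<=` setT] = cylinders J.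
  by apply/seteqP; split=> [E []|E].
apply: (@g_sigma_algebra_measure_unique_trace _ _ _ (cylinders J) setT) => //;
  rewrite ?HE.
- exact: cylinders_measurable.
- exact: cylinders_setI_closed.
- by rewrite m1E m2E setTI probability_setT mule1.
- move=> _ [C [mC ->]].
  pose C' j := if j == k then B else C j.
  have mC' j : measurable (C' j) by rewrite /C'; case: ifP.
  have C'E j : j \in J -> C' j = C j.
    by rewrite /C'; case: eqP => // -> kJ'; rewrite kJ' in kJ.
  have kJI : [set` (k |` J)%fset] `<=` I.
    by move=> j /=; rewrite !inE => /orP[/eqP ->|/JI].
  have C'k : C' k = B by rewrite /C' eqxx.
  have -> : \bigcap_(j in [set` J]) w j @^-1` C j =
            \bigcap_(j in [set` J]) w j @^-1` C' j.
    by apply: eq_bigcapr => j jJ; rewrite C'E.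
  rewrite m1E m2E -C'k (wI J C')//.
  rewrite -(big_fsetU1 _ (fun j => P (w j @^-1` C' j)))//= -(wI _ C')//; congr (P _).
  apply/seteqP; split=> [x [wC wk] j|x wC] /=.
    by rewrite !inE => /predU1P[->//|jJ]; exact: wC.
  by split=> [j jJ|]; apply: wC; rewrite /= !inE ?eqxx// jJ orbT.
- by rewrite m1E setTI (le_lt_trans (probability_le1 P mwB))// ltry.
- by have := mX measurableT A mA; rewrite setTI.
Qed.

End past_independence.

(** * The algorithm as a function of the published gradients *)

Section mechanism.
Context {R : realType} {T n : nat}.
Variables (U : 'rV[R]_T -> R) (alpha : nat -> R) (eta : R).
Variable r1 : 'I_n -> 'rV[R]_T.
Implicit Types (D : 'I_n -> set 'rV[R]_T) (p w : nat -> 'rV[R]_T).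

(** The iterates as a function of the published gradients [p] alone: the noise
    enters only through them. *)
Fixpoint iterates D p (k : nat) : 'I_n -> 'rV[R]_T :=
  if k is k'.+1 then
    fun i => Defs.proj (D i) (iterates D p k' i - alpha k *: p k)
  else r1.

Definition replayed_grad D p k : 'rV[R]_T := grad U (\sum_(i < n) iterates D p k i).

Lemma eq_iterates D p p' k : (forall j, (1 <= j <= k)%N -> p j = p' j) ->
  iterates D p k = iterates D p' k.
Proof.
elim: k => //= k IH pp'; rewrite IH; last first.
  by move=> j /andP[j1 jk]; apply: pp'; rewrite j1 ltnW.
by rewrite pp' ?leqnn.
Qed.

Lemma dpgd_iterE D w k :
  (dpgd_iter U alpha eta r1 D w k).1 = iterates D (dpgd_phat U alpha eta r1 D w) k.
Proof.
elim: k => // k; rewrite /= [in dpgd_phat _ _ _ _ _ _ k.+1]/dpgd_phat /=.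
by case: (dpgd_iter _ _ _ _ _ _ k) => r rhat /= ->.
Qed.

Lemma dpgd_phatE D w k : dpgd_phat U alpha eta r1 D w k.+1 =
  replayed_grad D (dpgd_phat U alpha eta r1 D w) k + (if k == 0%N then 0 else w k.+1).
Proof. by rewrite {1}/dpgd_phat /noisy_grad dpgd_iterE. Qed.

(** The published gradients being the same, the runs can differ at [i0] only.
    One step there compares [proj (D i0) x] with [proj (D' i0) y] through
    [proj (D' i0) x]: the sensitivity bounds the first half, nonexpansiveness the
    second. *)
Lemma iterates_gap D D' i0 (Delta : R) p k :
  (forall i, @convex_set R 'rV[R]_T (D' i)) ->
  (forall i, proj_well_defined (D' i)) ->
  (forall r, l2norm (Defs.proj (D i0) r - Defs.proj (D' i0) r) <= Delta) ->
  (forall j, j != i0 -> D j = D' j) ->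
  l2norm (\sum_(i < n) iterates D p k i - \sum_(i < n) iterates D' p k i) <=
    k%:R * Delta.
Proof.
move=> convD' projD' Delta_ge DD'.
have same j : j != i0 -> iterates D p k j = iterates D' p k j.
  by move=> ji0; elim: k => //= k ->; rewrite DD'.
rewrite (bigD1 i0)//= [X in _ - X](bigD1 i0)//=.
rewrite (eq_bigr (fun j => iterates D' p k j))//.
rewrite opprD addrACA subrr addr0 {same}.
elim: k => [|k IH]; first by rewrite subrr l2norm0 mul0r.
rewrite /=; set x := iterates D p k i0 - _; set y := iterates D' p k i0 - _.
rewrite -(subrKA (Defs.proj (D' i0) x)) -natr1 mulrDl mul1r [leRHS]addrC.
apply: le_trans (ler_l2normD _ _) _; apply: lerD => //.
apply: le_trans (proj_nonexpansive _ _ (convD' i0) (projD' i0)) _.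
by rewrite /x /y opprB addrA subrK.
Qed.

Section measurability.
Hypothesis mgrad : measurable_fun setT (grad U).
Variable D : 'I_n -> set 'rV[R]_T.
Hypothesis convD : forall i, @convex_set R 'rV[R]_T (D i).
Hypothesis projD : forall i, proj_well_defined (D i).
Context d (Y : measurableType d).

Lemma measurable_iterates (p : Y -> nat -> 'rV[R]_T) k i :
  (forall j, (1 <= j <= k)%N -> measurable_fun setT (p^~ j)) ->
  measurable_fun setT (fun y => iterates D (p y) k i).
Proof.
elim: k i => [|k IH] i mp /=; first exact: measurable_cst.
have mproj : measurable_fun setT (Defs.proj (D i)).
  apply: continuous_measurable_mx.
  apply: (@l2norm_lipschitz_continuous _ _ _ _ 1) => // x y.
  by rewrite mul1r; exact: proj_nonexpansive.
apply: (measurableT_comp mproj); apply: measurable_rV_add.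
  by apply: IH => j /andP[j1 jk]; apply: mp; rewrite j1 ltnW.
apply: measurable_rVP => j; under eq_fun do rewrite !mxE.
apply: measurable_funN; apply: measurable_funM; first exact: measurable_cst.
by apply: (measurableT_comp (measurable_coord j)); apply: mp; rewrite leqnn.
Qed.

Lemma measurable_replayed_grad (p : Y -> nat -> 'rV[R]_T) k :
  (forall j, (1 <= j <= k)%N -> measurable_fun setT (p^~ j)) ->
  measurable_fun setT (fun y => replayed_grad D (p y) k).
Proof.
move=> mp; apply: (measurableT_comp mgrad); apply: measurable_rVP => j.
under eq_fun do rewrite summxE; apply: measurable_sum => i.
by apply: (measurableT_comp (measurable_coord j)); exact: measurable_iterates.
Qed.

Lemma measurable_phat (w : Y -> nat -> 'rV[R]_T) k :
  (forall j, (2 <= j <= k.+1)%N -> measurable_fun setT (w^~ j)) ->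
  measurable_fun setT (fun y => dpgd_phat U alpha eta r1 D (w y) k.+1).
Proof.
elim/ltn_ind: k => k IH mw; under eq_fun do rewrite dpgd_phatE.
apply: measurable_rV_add.
  apply: measurable_replayed_grad => -[//|j] /= jk; apply: IH => // i /andP[i2 ij].
  by apply: mw; rewrite i2 ltnW// (leq_ltn_trans ij).
by case: k IH mw => [|k] _ mw /=; [exact: measurable_cst|apply: mw; rewrite /= ltnS].
Qed.

Lemma measurable_mech_p (w : Y -> nat -> 'rV[R]_T) k :
  (forall j, (2 <= j <= k)%N -> measurable_fun setT (w^~ j)) ->
  measurable_fun setT (fun y => mech_p U alpha eta r1 D (w y) k).
Proof.
move=> mw; apply/measurable_fun_tnthP => i.
rewrite (_ : _ \o _ = fun y => dpgd_phat U alpha eta r1 D (w y) i.+1).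
  apply: measurable_phat => j /andP[j2 ji]; apply: mw.
  by rewrite j2 (leq_trans ji).
by apply/funext => y /=; rewrite tnth_mktuple.
Qed.

End measurability.
End mechanism.

Section tuple_extension.
Context d (V : measurableType d) (m : nat).

(** The default value of [nth] supplies the last entry. *)
Definition snoc (p : m.-tuple V * V) : m.+1.-tuple V :=
  [tuple nth p.2 p.1 i | i < m.+1].

Lemma measurable_nth_tuple (x : V) i : measurable_fun setT (fun t : m.-tuple V => nth x t i).
Proof.
have [im|mi] := ltnP i m.
  under eq_fun do rewrite -(tnth_nth x _ (Ordinal im)).
  exact: measurable_tnth.
by under eq_fun do rewrite nth_default ?size_tuple//; exact: measurable_cst.
Qed.

Lemma measurable_snoc : measurable_fun setT snoc.
Proof.
apply/measurable_fun_tnthP => i.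
have [im|mi] := ltnP i m.
  rewrite (_ : _ \o _ = (tnth (T:=V))^~ (Ordinal im) \o fst).
    by apply: measurableT_comp => //; exact: measurable_tnth.
  by apply/funext => p /=; rewrite tnth_mktuple (tnth_nth p.2).
rewrite (_ : _ \o _ = snd)//.
by apply/funext => p /=; rewrite tnth_mktuple nth_default ?size_tuple.
Qed.

End tuple_extension.
Arguments snoc {d V m} p.

(** * Privacy *)

Lemma proj_sensitivity_ubound (R : realType) (s T n : nat)
    (C : 'rV[R]_s -> set 'rV[R]_T) (rho : 'rV[R]_s -> 'rV[R]_s -> R) (dC : R)
    (Delta : R) (i : 'I_n) (A A' : set 'rV[R]_T) (r : 'rV[R]_T) :
  Delta%:E = proj_sensitivity n C rho dC -> rhoC_le C rho dC A A' ->
  l2norm (Defs.proj A r - Defs.proj A' r) <= Delta.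
Proof.
move=> DeltaE AA'; rewrite -lee_fin DeltaE.
apply: (@le_trans _ _ (ereal_sup [set e | exists (r : 'rV[R]_T) A A',
    rhoC_le C rho dC A A' /\ e = (l2norm (Defs.proj A r - Defs.proj A' r))%:E])).
  by apply: ereal_sup_ubound; exists r, A, A'.
by apply: ereal_sup_ubound; exists i.
Qed.

(** Publishing one more gradient after [m] of them costs a factor
    [expR (gamma * L * m * Delta)], since [m * Delta] bounds the gap between the
    two runs; over the first [m] gradients the exponents add up to
    [gamma * L * Delta] times [m (m - 1) / 2].  The very first gradient carries no noise and depends on [r1] only, hence costs nothing. *)
Lemma mech_p_private_prefix (R : realType) (T n K : nat) (U : 'rV[R]_T -> R) (L : R)
    (alpha : nat -> R) (eta : R) (r1 : 'I_n -> 'rV[R]_T)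
    (D D' : 'I_n -> set 'rV[R]_T) (Delta gamma : R) (i0 : 'I_n)
    d (Omega : measurableType d) (P : probability Omega R)
    (w : nat -> {RV P >-> 'rV[R]_T}) :
  0 <= L -> (forall x y, l2norm (grad U x - grad U y) <= L * l2norm (x - y)) ->
  (forall i, @convex_set R 'rV[R]_T (D i)) ->
  (forall i, @convex_set R 'rV[R]_T (D' i)) ->
  (forall i, proj_well_defined (D i)) -> (forall i, proj_well_defined (D' i)) ->
  (forall r, l2norm (Defs.proj (D i0) r - Defs.proj (D' i0) r) <= Delta) ->
  (forall j, j != i0 -> D j = D' j) ->
  0 <= gamma ->
  (forall k, (2 <= k <= K)%N ->
     density_prop_to (w k) (fun x => expR (- (gamma * l2norm x)))) ->
  mutually_independent [set k | (2 <= k <= K)%N] w ->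
  forall m, (m <= K)%N -> forall S, measurable S ->
  (P [set o | S (mech_p U alpha eta r1 D (fun k => w k o) m)] <=
   (expR (gamma * L * Delta * (m%:R * (m%:R - 1) / 2)))%:E *
   P [set o | S (mech_p U alpha eta r1 D' (fun k => w k o) m)])%E.
Proof.
move=> L0 lipU convD convD' projD projD' Delta_ge DD' gamma0 wdens windep.
have mgrad : measurable_fun setT (grad U).
  by apply: continuous_measurable_mx; exact: l2norm_lipschitz_continuous lipU.
pose M E m o := mech_p U alpha eta r1 E (fun k => w k o) m.
have small m : (m <= 1)%N -> M D m = M D' m.
  move=> m1; apply/funext => x; apply: eq_from_tnth => i; rewrite !tnth_mktuple.
  by case: m m1 i => [|[|//]] _ [[]].
elim=> [|m IH] mK S mS.
  rewrite !mul0r mulr0 expR0 mul1e.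
  by rewrite -[X in (P X <= _)%E]/[set o | S (M D 0%N o)] small.
case: (posnP m) S mS mK IH => [-> S _ _ _|m0 S mS mK IH].
  rewrite subrr mulr0 mul0r mulr0 expR0 mul1e.
  by rewrite -[X in (P X <= _)%E]/[set o | S (M D 1%N o)] small.
(* The noises that the first m gradients depend on. *)
pose J := [fset j in iota 2 m.-1]%fset.
have JE j : (j \in J) = (2 <= j <= m)%N.
  by rewrite !inE mem_iota addSn add1n prednK.
have observed E : (forall i, @convex_set R 'rV[R]_T (E i)) ->
    (forall i, proj_well_defined (E i)) ->
    measurable_fun setT (M E m : g_sigma_algebraType (cylinders w J) -> _).
  move=> convE projE; apply: measurable_mech_p => // j jm.
  by apply: measurable_observed; rewrite JE.
have oD := observed _ convD projD; have oD' := observed _ convD' projD'.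
pose X : {RV P >-> m.-tuple 'rV[R]_T} := HB.pack (M D m)
  (isMeasurableFun.Build _ _ _ _ _ (observed_measurable oD)).
pose X' : {RV P >-> m.-tuple 'rV[R]_T} := HB.pack (M D' m)
  (isMeasurableFun.Build _ _ _ _ _ (observed_measurable oD')).
have m1K : (2 <= m.+1 <= K)%N by rewrite ltnS m0.
have JK : [set` J] `<=` [set k | (2 <= k <= K)%N].
  by move=> j; rewrite /= JE => /andP[-> /leq_trans->]//; exact: ltnW.
have m1J : m.+1 \notin J by rewrite JE ltnn andbF.
pose hist (t : m.-tuple 'rV[R]_T) j := nth 0 t j.-1.
pose f E (q : m.-tuple 'rV[R]_T * 'rV[R]_T) :=
  replayed_grad U alpha r1 E (hist q.1) m + q.2.
have mf E : (forall i, @convex_set R 'rV[R]_T (E i)) ->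
    (forall i, proj_well_defined (E i)) -> measurable_fun setT (f E).
  move=> convE projE; apply: measurable_rV_add => //.
  apply: measurable_replayed_grad => // j _.
  apply: (measurableT_comp (f := fun t : m.-tuple 'rV[R]_T => nth 0 t j.-1)) => //.
  exact: measurable_nth_tuple.
have nthM E j x o : (j < m)%N ->
    nth x (M E m o) j = dpgd_phat U alpha eta r1 E (fun k => w k o) j.+1.
  by move=> jm; rewrite -(tnth_nth x _ (Ordinal jm)) tnth_mktuple.
have snocM E o : M E m.+1 o = snoc (M E m o, f E (M E m o, w m.+1 o)).
  apply: eq_from_tnth => i; rewrite !tnth_mktuple /=.
  have [im|mi] := ltnP i m; first by rewrite nthM.
  have -> : i = m :> nat by apply/eqP; rewrite eqn_leq mi -ltnS ltn_ord.
  rewrite nth_default ?size_tuple ?card_ord// dpgd_phatE gtn_eqF// /f /replayed_grad.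
  rewrite (@eq_iterates _ _ _ alpha r1 E _ (hist (M E m o)))// => -[//|j] /= jm.
  by rewrite /hist nthM.
pose S' : set (m.-tuple 'rV[R]_T * 'rV[R]_T) := snoc @^-1` S.
have mS' : measurable S'.
  by rewrite -[X in measurable X]setTI; exact: measurable_snoc.
have SE E : [set o | S (M E m.+1 o)] = [set o | S' (M E m o, f E (M E m o, w m.+1 o))].
  by apply/seteqP; split=> o; rewrite /S' /= snocM.
rewrite !SE.
have -> : expR (gamma * L * Delta * (m.+1%:R * (m.+1%:R - 1) / 2)) =
    expR (gamma * L * Delta * (m%:R * (m%:R - 1) / 2)) *
    expR (gamma * (L * (m%:R * Delta))).
  by rewrite -expRD -natr1; congr expR; field.
apply: (@adaptive_composition _ _ _ _ _ _ _ _ _ P X X' (w m.+1)) => //.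
- exact: past_independent windep JK m1K m1J oD.
- exact: past_independent windep JK m1K m1J oD'.
- exact: mf.
- exact: mf.
- by move=> A mA; apply: IH => //; exact: ltnW.
move=> t B mB.
have := density_shift gamma0 (wdens _ m1K) (replayed_grad U alpha r1 D (hist t) m)
  (replayed_grad U alpha r1 D' (hist t) m) mB.
move=> /le_trans; apply; rewrite lee_wpmul2r// lee_fin ler_expR ler_wpM2l//.
by apply: le_trans (lipU _ _) _; rewrite ler_wpM2l// (@iterates_gap _ _ _ _ _ _ _ i0).
Qed.

Theorem theorem6 (R : realType) (T n s K : nat)
  (U : 'rV[R]_T -> R) (L : R)
  (hUconvex : @convex_function R 'rV[R]_T setT U)
  (hUdiff : forall x, differentiable U x)
  (hL : 0 < L)
  (hUlip : forall x y, l2norm (grad U x - grad U y) <= L * l2norm (x - y))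
  (C : 'rV[R]_s -> set 'rV[R]_T)
  (hCconvex : forall b, @convex_set R 'rV[R]_T (C b))
  (hCproj : forall b, proj_well_defined (C b))
  (rho : 'rV[R]_s -> 'rV[R]_s -> R) (hrho : is_metric rho)
  (dC : R) (hdC : 0 <= dC)
  (Delta : R) (hDelta0 : 0 < Delta)
  (hDelta : Delta%:E = proj_sensitivity n C rho dC)
  (eps : R) (heps : 0 < eps)
  (alpha : nat -> R) (eta : R) (heta : 1 <= eta)
  (r1 : 'I_n -> 'rV[R]_T)
  (d : measure_display) (Omega : measurableType d) (P : probability Omega R)
  (w : nat -> {RV P >-> 'rV[R]_T})
  (hwdens : forall k, (2 <= k <= K)%N ->
     density_prop_to (w k)
       (fun x => expR (- (2 * eps * l2norm x /
                          (K%:R * (K%:R - 1) * L * Delta)))))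
  (hwindep : mutually_independent [set k | (2 <= k <= K)%N] w) :
  differentially_private P (@database R s T n C) (@Adj R s T n C rho dC)
    (fun D omega => mech_p U alpha eta r1 D (fun k => w k omega) K) eps.
Proof.
move=> D D' dbD dbD' [i [Dii DD']] S mS.
have convE (E : 'I_n -> set 'rV[R]_T) : database C E -> forall j, @convex_set R 'rV[R]_T (E j).
  by move=> dbE j; have [b ->] := dbE j.
have projE (E : 'I_n -> set 'rV[R]_T) : database C E -> forall j, proj_well_defined (E j).
  by move=> dbE j; have [b ->] := dbE j.
pose c := K%:R * (K%:R - 1) * L * Delta.
have c0 : 0 <= c.
  apply: mulr_ge0 (ltW hDelta0); apply: mulr_ge0 (ltW hL).
  by case: (K) => [|k]; rewrite ?mul0r// mulr_ge0// subr_ge0 ler1n.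
have gamma0 : 0 <= 2 * eps / c by rewrite divr_ge0// mulr_ge0// ltW.
have wdens k : (2 <= k <= K)%N ->
    density_prop_to (w k) (fun x => expR (- (2 * eps / c * l2norm x))).
  move=> /hwdens; congr (density_prop_to _ _).
  by apply/funext => x; rewrite mulrAC.
have := mech_p_private_prefix alpha eta r1 (ltW hL) hUlip (convE _ dbD) (convE _ dbD')
  (projE _ dbD) (projE _ dbD') (fun r => proj_sensitivity_ubound i r hDelta Dii) DD'
  gamma0 wdens hwindep (leqnn K) mS.
move=> /le_trans; apply; rewrite lee_wpmul2r// lee_fin ler_expR.
(* c = 0 means K <= 1: no noise is drawn, and the total exponent is 0. *)
have [cz|cz] := eqVneq c 0.
  by rewrite cz invr0 mulr0 !mul0r ltW.
rewrite [leLHS](_ : _ = eps)// -[RHS](mulfK cz) {2}/c.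
by move: (c) cz => e e0; field.
Qed.
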